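(* Let $\mathfrak{g}$ be a 2-step nilpotent Lie algebra which admits a complex structure $J$. Then $2\leq\nu(J)\leq 3$.
   Context: Lie algebras are real, of finite positive dimension. $\mathfrak{g}$ is $s$-step nilpotent if $\mathfrak{g}^s=0$ and $\mathfrak{g}^{s-1}\ne0$, where $\mathfrak{g}^0=\mathfrak{g}$, $\mathfrak{g}^k=[\mathfrak{g}^{k-1},\mathfrak{g}]$. A complex structure on $\mathfrak{g}$ is a linear endomorphism $J:\mathfrak{g}\to\mathfrak{g}$ with $J^2=-1$ and $[JX,JY]=J[JX,Y]+J[X,JY]+[X,Y]$ for all $X,Y\in\mathfrak{g}$. Put $\mathfrak{a}_0=0$ and $\mathfrak{a}_k=\{X\in\mathfrak{g} : [X,\mathfrak{g}]\subseteq\mathfrak{a}_{k-1},\ [JX,\mathfrak{g}]\subseteq\mathfrak{a}_{k-1}\}$ for $k\ge1$. $J$ is called nilpotent if $\mathfrak{a}_t=\mathfrak{g}$ for some $t$, and then $\nu(J)$ is the smallest such $t$. (Every complex structure on a 2-step nilpotent Lie algebra is nilpotent, so $\nu(J)$ is defined here.) *)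

(* Defs.v *)
From HB Require Import structures.
From mathcomp Require Import all_boot all_order all_algebra.
From mathcomp Require Import boolp classical_sets reals.

Set Implicit Arguments.
Unset Strict Implicit.
Unset Printing Implicit Defensive.

Import GRing.Theory.
Local Open Scope ring_scope.

(* Finite-dimensional Lie algebras: the dimension is finite since the carrier
   is a vectType; it may be zero. *)
HB.mixin Record isLieAlgebra (K : fieldType) V of Vector K V := {
  lie : V -> V -> V;
  lie_linearl : forall y, linear (lie^~ y);
  lie_linearr : forall x, linear (lie x);
  lie_xx : forall x, lie x x = 0;
  lie_jacobi : forall x y z,
    lie x (lie y z) + lie y (lie z x) + lie z (lie x y) = 0
}.

#[short(type="lieAlgType")]
HB.structure Definition LieAlgebra (K : fieldType) :=
  {V of isLieAlgebra K V & Vector K V}.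

Section LowerCentralSeries.
Variables (K : fieldType) (g : lieAlgType K).
Implicit Types (U W Z : {vspace g}).

(* [U, W], the span of all the brackets lie x y with x in U and y in W, given
   by bases as for prodv in falgebra; see lie_prodvP. *)
Definition lie_prodv U W : {vspace g} :=
  <<[seq lie x y | x <- vbasis U, y <- vbasis W]>>%VS.

Lemma memv_lie U W x y : x \in U -> y \in W -> lie x y \in lie_prodv U W.
Proof.
move=> Ux Wy.
have lie_suml n (c : 'I_n -> K) (v : 'I_n -> g) z :
    lie (\sum_i c i *: v i) z = \sum_i c i *: lie (v i) z.
  pose fM := GRing.isLinear.Build _ _ _ _ _ (lie_linearl z).
  pose f : {linear g -> g} := HB.pack (lie^~ z : g -> g) fM.
  rewrite -[LHS]/(f _) linear_sum; apply: eq_bigr => i _; exact: linearZ.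
have lie_sumr n (c : 'I_n -> K) (v : 'I_n -> g) z :
    lie z (\sum_i c i *: v i) = \sum_i c i *: lie z (v i).
  pose fM := GRing.isLinear.Build _ _ _ _ _ (lie_linearr z).
  pose f : {linear g -> g} := HB.pack (lie z : g -> g) fM.
  rewrite -[LHS]/(f _) linear_sum; apply: eq_bigr => i _; exact: linearZ.
rewrite (coord_vbasis Ux) lie_suml memv_suml // => i _; apply: memvZ.
rewrite (coord_vbasis Wy) lie_sumr memv_suml // => j _; apply: memvZ.
by apply/memv_span/allpairs_f; apply: mem_nth; rewrite size_tuple.
Qed.

Lemma lie_prodvP U W Z :
  reflect (forall x y, x \in U -> y \in W -> lie x y \in Z)
          (lie_prodv U W <= Z)%VS.
Proof.
apply: (iffP idP) => [/subvP sZ x y Ux Wy | sZ]; first exact/sZ/memv_lie.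
apply/span_subvP => _ /allpairsP[[x y] /= [Ux Wy ->]].
by apply: sZ; apply: vbasis_mem.
Qed.

Fixpoint lower_central (k : nat) : {vspace g} :=
  if k is k'.+1 then lie_prodv (lower_central k') fullv else fullv.

(* For s = 0 the two conditions contradict each other. *)
Definition step_nilpotent (s : nat) : Prop :=
  lower_central s = 0%VS /\ lower_central s.-1 <> 0%VS.

End LowerCentralSeries.

Arguments lower_central {K} g k.
Arguments step_nilpotent {K} g s.

Section ComplexStructure.
Variables (R : realType) (g : lieAlgType R).
Implicit Type J : 'End(g).

Definition complex_structure J : Prop :=
  (forall X, J (J X) = - X) /\
  (forall X Y, lie (J X) (J Y) = J (lie (J X) Y) + J (lie X (J Y)) + lie X Y).

Fixpoint asc_series J (k : nat) : set g :=
  if k is k'.+1 then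
    [set X | (forall Y, asc_series J k' (lie X Y)) /\
             (forall Y, asc_series J k' (lie (J X) Y))]%classic
  else [set 0]%classic.

(* The boolean reflection `[< _ >] is what allows nu to be an ex_minn; by ex_minnP
   the value of nu does not depend on the proof nilJ. *)
Definition nilpotent_structure J : Prop :=
  exists t, `[< asc_series J t = setT >].

Definition nu J (nilJ : nilpotent_structure J) : nat := ex_minn nilJ.

End ComplexStructure.

(* Main.v *)
Require Import Defs.
From mathcomp Require Import all_boot all_order all_algebra.
From mathcomp Require Import boolp classical_sets reals.
Import GRing.Theory.
Local Open Scope ring_scope.

(** The upper bound rests on one observation: if [c] is central, then the
    integrability condition for the pair [c], [W] loses the two terms that
    contain [c] itself and becomes [J [Jc, W] = [Jc, JW]]
    ([integrable_central]).  So [J] maps the bracket [[Jc, W]] to a bracket.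

    When the algebra is 2-step nilpotent all brackets are central, hence
    [[Jc, W]] and its image under [J] are both central, that is, [[Jc, W]] lies
    in [a_1].  Together with [[c, W] = 0] this says that every central [c] lies
    in [a_2] ([central_asc_series2]); brackets being central, [a_3] is
    everything.

    For the lower bound, [a_0] and [a_1] consist of central elements, so if one
    of them were the whole algebra, the derived algebra would vanish. *)

Section Brackets.
Variables (K : fieldType) (g : lieAlgType K).

Lemma lie0l (x : g) : lie 0 x = 0.
Proof.
by have := lie_linearl x (-1) 0 0; rewrite scaler0 addr0 scaleN1r addNr.
Qed.

Lemma step2_bracket_central :
  step_nilpotent g 2 -> forall x y z : g, lie (lie x y) z = 0.
Proof.
move=> [g2_0 _] x y z; apply/eqP; rewrite -memv0 -g2_0.
by do 2?[apply: memv_lie]; rewrite ?memvf.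
Qed.

Lemma step2_not_abelian :
  step_nilpotent g 2 -> ~ forall x y : g, lie x y = 0.
Proof.
move=> [_ g1_n0] g_ab; apply: g1_n0; apply/eqP; rewrite -subv0.
by apply/lie_prodvP => x y _ _; rewrite g_ab mem0v.
Qed.

End Brackets.

Section ComplexStructureSeries.
Variables (R : realType) (g : lieAlgType R) (J : 'End(g)).

Lemma integrable_central (c w : g) :
    complex_structure J -> (forall y, lie c y = 0) ->
  J (lie (J c) w) = lie (J c) (J w).
Proof. by move=> [_ integrJ] cZ; rewrite integrJ !cZ linear0 !addr0. Qed.

Lemma asc_series0 k : asc_series J k 0.
Proof.
by elim: k => [|k IHk] //=; split=> y; rewrite ?linear0 lie0l.
Qed.

(** This covers [k = 0] and [k = 1] at once, the two values to exclude for
    the index of nilpotency. *)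
Lemma asc_series_le1_central k (x : g) :
  (k <= 1)%N -> asc_series J k x -> forall y, lie x y = 0.
Proof. by case: k => [|[|//]] _ /= => [-> y|[]//]; rewrite lie0l. Qed.

Lemma central_asc_series2 (c : g) :
    step_nilpotent g 2 -> complex_structure J ->
    (forall y, lie c y = 0) -> asc_series J 2 c.
Proof.
move=> step2 cpxJ cZ; split=> w; first by rewrite cZ; apply: asc_series0.
split=> y; first exact: step2_bracket_central.
by rewrite integrable_central //; apply: step2_bracket_central.
Qed.

Lemma asc_series3_full :
  step_nilpotent g 2 -> complex_structure J -> asc_series J 3 = setT.
Proof.
move=> step2 cpxJ; apply/seteqP; split=> // x _.
by split=> y; apply: central_asc_series2 => // z; apply: step2_bracket_central.
Qed.

End ComplexStructureSeries.

Theorem theorem1p3 (R : realType) (g : lieAlgType R) (J : 'End(g))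
    (dim_gt0 : (0 < \dim {:g})%N)
    (step2 : step_nilpotent g 2)
    (cpxJ : complex_structure J) :
  exists nilJ : nilpotent_structure J, (2 <= nu nilJ <= 3)%N.
Proof.
have a3_full : `[< asc_series J 3 = setT >].
  by apply/asboolP; apply: asc_series3_full.
exists (ex_intro _ 3%N a3_full).
rewrite /nu; case: ex_minnP => t /asboolP at_full t_min.
rewrite t_min // andbT ltnNge; apply/negP => t_le1.
apply: (step2_not_abelian _ _ step2) => x.
by apply: (asc_series_le1_central _ _ J t x) => //; rewrite at_full.
Qed.
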